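(* Let $n>0$ be an integer. The functor $R^n_{\mathbb{Z}}$ is self-dual under Pontrjagin duality; more precisely, any surjection $\bar P_{\mathbb{Z}_2}\twoheadrightarrow DR^n_{\mathbb{Z}}$ (of functors) factors canonically, through the natural surjection $\bar P_{\mathbb{Z}_2}\twoheadrightarrow R^n_{\mathbb{Z}}$, across an isomorphism $R^n_{\mathbb{Z}}\xrightarrow{\cong}DR^n_{\mathbb{Z}}$.
   Context: Work in the abelian category of functors from finite-dimensional $\mathbb{F}_2$-vector spaces to abelian groups. $\bar P_{\mathbb{Z}}$ is the functor sending $V$ to the augmentation ideal of the integral group ring $\mathbb{Z}[V]$; $\bar P_{\mathbb{Z}_2}:=\mathbb{Z}_2\otimes\bar P_{\mathbb{Z}}$, where $\mathbb{Z}_2$ denotes the $2$-adic integers. For $n\geq 1$, $\bar P_{\mathbb{Z}}^{\,n}\subset\bar P_{\mathbb{Z}}$ is the $n$-th power (image of the iterated product $\bar P_{\mathbb{Z}}^{\otimes n}\to\bar P_{\mathbb{Z}}$), and $R^n_{\mathbb{Z}}:=\bar P_{\mathbb{Z}}/\bar P_{\mathbb{Z}}^{\,n+1}$; it takes values in finite $2$-groups, so is naturally a quotient of $\bar P_{\mathbb{Z}_2}$. The Pontrjagin dual of a functor $F$ is $DF(V):=\mathrm{Hom}(F(V^\sharp),\mathbb{Z}/2^\infty)$, where $V^\sharp$ is the dual vector space. *)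

(* Defs.v *)
From HB Require Import structures.
From mathcomp Require Import all_boot all_order all_algebra.
From mathcomp Require Import boolp functions.
From mathcomp Require Import freeg.

Set Implicit Arguments.
Unset Strict Implicit.
Unset Printing Implicit Defensive.

Import Order.TTheory GRing.Theory Num.Theory.
Local Open Scope ring_scope.
Local Open Scope quotient_scope.

Section FreeLift.
Context (X : choiceType) (M : zmodType).

Definition flift (f : X -> M) : {freeg X} -> M :=
  fglift (f : X -> zmodule M).

Fact flift_is_zmod_morphism f : zmod_morphism (flift f).
Proof. exact: (@lift_is_additive int X (zmodule M)). Qed.

HB.instance Definition _ f :=
  GRing.isZmodMorphism.Build {freeg X} M (flift f) (flift_is_zmod_morphism f).

Lemma fliftU f x : flift f << x >> = f x.
Proof. by rewrite /flift liftU scale1r. Qed.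

Lemma eq_freeg_additive (f g : {additive {freeg X} -> M}) :
  (forall x, f << x >> = g << x >>) -> f =1 g.
Proof.
move=> fg D; rewrite -(freeg_sumE D) !raddf_sum; apply: eq_bigr => x _.
by rewrite -(intz (coeff x D)) -freegU_mulz !raddfMz fg.
Qed.

Lemma freeg_ind (P : {freeg X} -> Prop) :
    P 0 -> (forall x y, P x -> P y -> P (x - y)) -> (forall x, P << x >>) ->
  forall D, P D.
Proof.
move=> P0 PB PU D; rewrite -(freeg_sumE D).
have PN x : P x -> P (- x) by rewrite -sub0r; apply: PB.
have PD x y : P x -> P y -> P (x + y) by move=> ? /PN; rewrite -{2}(opprK y); apply: PB.
elim/big_ind: _ => // x _; rewrite -(intz (coeff x D)) -freegU_mulz.
have Pn n : P (<< x >> *+ n) by elim: n => // n IHn; rewrite mulrS; apply: PD.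
by case: (coeff x D) => n; [apply: Pn | apply: PN].
Qed.

End FreeLift.

Section QuotientGroup.
Context (A : zmodType) (I : zmodClosed A).

Definition quot : zmodType := Quotient.quot I.

Definition qpi : {additive A -> quot} := \pi_(Quotient.quot I).

Lemma qpi_surj (y : quot) : exists x, qpi x = y.
Proof. by exists (repr (y : Quotient.quot I)); apply: reprK. Qed.

Lemma qpi_eq0 x : (qpi x == 0) = (x \in I).
Proof. by rewrite -(raddf0 qpi) -[x in RHS]subr0 Quotient.idealrBE. Qed.

Context (M : zmodType) (f : {additive A -> M}).
Hypothesis fI : forall x, x \in I -> f x = 0.

Let qlift_fun (q : quot) : M := f (repr (q : Quotient.quot I)).

Let qlift_fun_pi x : qlift_fun (qpi x) = f x.
Proof.
apply/eqP; rewrite -subr_eq0 -raddfB; apply/eqP/fI.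
by rewrite Quotient.idealrBE reprK.
Qed.

Fact qlift_is_zmod_morphism : zmod_morphism qlift_fun.
Proof.
move=> x y; have [[a <-] [b <-]] := (qpi_surj x, qpi_surj y).
by rewrite -raddfB !qlift_fun_pi raddfB.
Qed.

Definition qlift : {additive quot -> M} :=
  HB.pack_for {additive quot -> M} qlift_fun
    (GRing.isZmodMorphism.Build _ _ qlift_fun qlift_is_zmod_morphism).

Lemma qlift_pi x : qlift (qpi x) = f x.
Proof. exact: qlift_fun_pi. Qed.

End QuotientGroup.

Section Hom.
Context (A B : zmodType).

Definition addhom_pred : {pred A -> B} := fun f => `[< zmod_morphism f >].

Record addhom := AddHom { addhom_fun :> A -> B; _ : addhom_fun \in addhom_pred }.

HB.instance Definition _ := [isSub for addhom_fun].
HB.instance Definition _ := [Choice of addhom by <:].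

Fact addhom_pred_zmod_closed : zmod_closed addhom_pred.
Proof.
split=> [|f g /asboolP hf /asboolP hg]; apply/asboolP => x y.
  by rewrite /= subr0.
have E (k l : A -> B) z : (k - l) z = k z - l z by [].
by rewrite !E hf hg !opprD !opprK addrACA.
Qed.
HB.instance Definition _ :=
  GRing.isZmodClosed.Build (A -> B) addhom_pred addhom_pred_zmod_closed.
HB.instance Definition _ := [SubChoice_isSubZmodule of addhom by <:].

Fact addhom_is_zmod_morphism (f : addhom) : zmod_morphism f.
Proof. by case: f => f /= /asboolP. Qed.
HB.instance Definition _ (f : addhom) :=
  GRing.isZmodMorphism.Build A B f (addhom_is_zmod_morphism f).

Fact mkaddhom_subproof (f : {additive A -> B}) : (f : A -> B) \in addhom_pred.
Proof. by apply/asboolP => x y; rewrite raddfB. Qed.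
Definition mkaddhom (f : {additive A -> B}) : addhom := AddHom (mkaddhom_subproof f).

Lemma addhomP (f g : addhom) : f =1 g -> f = g.
Proof. by move=> fg; apply/val_inj/funext. Qed.

Lemma addhomBE (f g : addhom) x : (f - g) x = f x - g x.
Proof. by rewrite -[(f - g) x]/(val (f - g) x) raddfB. Qed.

End Hom.

Section Tensor.
Context (A B : zmodType).

Definition tensor_rels (x : {freeg A * B}) : Prop :=
  (exists a a' b, x = << (a + a', b) >> - << (a, b) >> - << (a', b) >>) \/
  (exists a b b', x = << (a, b + b') >> - << (a, b) >> - << (a, b') >>).

(* The subgroup of the free abelian group on A * B generated by the
   bilinearity relations. *)
Definition tensor_sub : {pred {freeg A * B}} := fun x =>
  `[< forall S : {pred {freeg A * B}}, zmod_closed S ->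
      (forall y, tensor_rels y -> y \in S) -> x \in S >].

Fact tensor_sub_zmod_closed : zmod_closed tensor_sub.
Proof.
split=> [|x y /asboolP xS /asboolP yS]; apply/asboolP => S SZ relS.
  by case: SZ.
by apply: SZ.2; [apply: xS | apply: yS].
Qed.
HB.instance Definition _ :=
  GRing.isZmodClosed.Build {freeg A * B} tensor_sub tensor_sub_zmod_closed.

Definition tensor : zmodType := quot tensor_sub.

Definition tens (a : A) (b : B) : tensor := qpi tensor_sub << (a, b) >>.

Lemma tensDl a a' b : tens (a + a') b = tens a b + tens a' b.
Proof.
apply/eqP; rewrite -subr_eq0 opprD addrA -!raddfB qpi_eq0.
by apply/asboolP => S _; apply; left; exists a, a', b.
Qed.

Lemma tensDr a b b' : tens a (b + b') = tens a b + tens a b'.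
Proof.
apply/eqP; rewrite -subr_eq0 opprD addrA -!raddfB qpi_eq0.
by apply/asboolP => S _; apply; right; exists a, b, b'.
Qed.

Lemma eq_tensor_additive (M : zmodType) (f g : {additive tensor -> M}) :
  (forall a b, f (tens a b) = g (tens a b)) -> f =1 g.
Proof.
move=> fg x; have [y <-] := qpi_surj x.
apply: (@eq_freeg_additive _ _ (f \o qpi tensor_sub) (g \o qpi tensor_sub)) => -[a b].
exact: fg.
Qed.

End Tensor.

Section TensorLift.
Context (A B M : zmodType) (h : A -> B -> M).
Hypothesis hDl : forall a a' b, h (a + a') b = h a b + h a' b.
Hypothesis hDr : forall a b b', h a (b + b') = h a b + h a b'.

Let h0 : {additive {freeg A * B} -> M} := flift (fun ab => h ab.1 ab.2).

Fact tlift_subproof x : x \in @tensor_sub A B -> h0 x = 0.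
Proof.
move=> /asboolP xI; apply/eqP.
apply: (xI [pred y | h0 y == 0]).
  split=> [|y z]; rewrite !inE; first by rewrite raddf0.
  by move=> /eqP y0 /eqP z0; rewrite raddfB y0 z0 subr0.
by move=> y [[a [a' [b ->]]]|[a [b [b' ->]]]];
  rewrite inE !raddfB /h0 /= !fliftU /= ?hDl ?hDr -addrA -opprD subrr.
Qed.

Definition tlift : {additive tensor A B -> M} := qlift tlift_subproof.

Lemma tliftE a b : tlift (tens a b) = h a b.
Proof. by rewrite /tlift /tens qlift_pi /h0 /= fliftU. Qed.

End TensorLift.

Section TwoAdicIntegers.

(* Z/2^n is indexed from n = 1 since 'Z_(2 ^ 0) would not be the zero ring;
   this does not change the inverse limit. *)
Definition Zpow2_prod := forall n, 'Z_(2 ^ n.+1).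

HB.instance Definition _ := Choice.on Zpow2_prod.

Definition zp2_add (x y : Zpow2_prod) : Zpow2_prod := fun n => x n + y n.
Definition zp2_opp (x : Zpow2_prod) : Zpow2_prod := fun n => - x n.
Definition zp2_mul (x y : Zpow2_prod) : Zpow2_prod := fun n => x n * y n.
Definition zp2_zero : Zpow2_prod := fun n => 0.
Definition zp2_one : Zpow2_prod := fun n => 1.

Fact zp2_addA : associative zp2_add.
Proof. by move=> x y z; apply: functional_extensionality_dep => n; apply: addrA. Qed.
Fact zp2_addC : commutative zp2_add.
Proof. by move=> x y; apply: functional_extensionality_dep => n; apply: addrC. Qed.
Fact zp2_add0 : left_id zp2_zero zp2_add.
Proof. by move=> x; apply: functional_extensionality_dep => n; apply: add0r. Qed.
Fact zp2_addN : left_inverse zp2_zero zp2_opp zp2_add.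
Proof. by move=> x; apply: functional_extensionality_dep => n; apply: addNr. Qed.
HB.instance Definition _ :=
  GRing.isZmodule.Build Zpow2_prod zp2_addA zp2_addC zp2_add0 zp2_addN.

Fact zp2_mulA : associative zp2_mul.
Proof. by move=> x y z; apply: functional_extensionality_dep => n; apply: mulrA. Qed.
Fact zp2_mulC : commutative zp2_mul.
Proof. by move=> x y; apply: functional_extensionality_dep => n; apply: mulrC. Qed.
Fact zp2_mul1 : left_id zp2_one zp2_mul.
Proof. by move=> x; apply: functional_extensionality_dep => n; apply: mul1r. Qed.
Fact zp2_mulDl : left_distributive zp2_mul zp2_add.
Proof. by move=> x y z; apply: functional_extensionality_dep => n; apply: mulrDl. Qed.
Fact zp2_one_neq0 : zp2_one != 0.
Proof. by apply/eqP => /(congr1 (@^~ 0%N)). Qed.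
HB.instance Definition _ :=
  GRing.Zmodule_isComNzRing.Build Zpow2_prod
    zp2_mulA zp2_mulC zp2_mul1 zp2_mulDl zp2_one_neq0.

Definition Zpow2_red n (a : 'Z_(2 ^ n.+2)) : 'Z_(2 ^ n.+1) := (a : nat)%:R.

Fact Zpow2_gt1 n : (1 < 2 ^ n.+1)%N.
Proof. by rewrite -(expn0 2) ltn_exp2l. Qed.

Lemma Zpow2_natr_mod n k m : (n <= m)%N ->
  (k %% 2 ^ m.+1)%:R = k%:R :> 'Z_(2 ^ n.+1).
Proof.
move=> le_nm; rewrite -(Zp_nat_mod (Zpow2_gt1 n)) modn_dvdm ?Zp_nat_mod ?Zpow2_gt1 //.
exact: dvdn_exp2l.
Qed.

Lemma val_Zpow2_nat n k : (k%:R : 'Z_(2 ^ n.+1)) = (k %% 2 ^ n.+1)%N :> nat.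
Proof. exact/val_Zp_nat/Zpow2_gt1. Qed.

Fact Zpow2_red_nat n k : @Zpow2_red n k%:R = k%:R.
Proof. by rewrite /Zpow2_red val_Zpow2_nat Zpow2_natr_mod. Qed.

Fact Zpow2_red_monoid_morphism n : monoid_morphism (@Zpow2_red n).
Proof.
split=> [|a b]; first exact: (Zpow2_red_nat n 1).
by rewrite -(natr_Zp a) -(natr_Zp b) -natrM !Zpow2_red_nat natrM.
Qed.
Fact Zpow2_red_zmod_morphism n : zmod_morphism (@Zpow2_red n).
Proof.
have redD : {morph @Zpow2_red n : a b / a + b}.
  by move=> a b; rewrite -(natr_Zp a) -(natr_Zp b) -natrD !Zpow2_red_nat natrD.
by move=> a b; apply/eqP; rewrite eq_sym subr_eq -redD subrK.
Qed.
HB.instance Definition _ n :=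
  GRing.isZmodMorphism.Build _ _ (@Zpow2_red n) (@Zpow2_red_zmod_morphism n).
HB.instance Definition _ n :=
  GRing.isMonoidMorphism.Build _ _ (@Zpow2_red n) (@Zpow2_red_monoid_morphism n).

Definition Z2_pred : {pred Zpow2_prod} := fun x =>
  `[< forall n, Zpow2_red (x n.+1) = x n >].

Fact Z2_pred_subring_closed : subring_closed Z2_pred.
Proof.
split=> [|x y /asboolP xS /asboolP yS|x y /asboolP xS /asboolP yS];
  apply/asboolP => n.
- by rewrite rmorph1.
- by rewrite -[LHS]/(Zpow2_red (x n.+1 - y n.+1)) rmorphB /= xS yS.
- by rewrite -[LHS]/(Zpow2_red (x n.+1 * y n.+1)) rmorphM /= xS yS.
Qed.
HB.instance Definition _ :=
  GRing.isSubringClosed.Build Zpow2_prod Z2_pred Z2_pred_subring_closed.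

Record Z2 := MkZ2 { Z2_seq : Zpow2_prod; _ : Z2_seq \in Z2_pred }.

HB.instance Definition _ := [isSub for Z2_seq].
HB.instance Definition _ := [Choice of Z2 by <:].
HB.instance Definition _ := [SubChoice_isSubComNzRing of Z2 by <:].

Lemma Z2D (x y : Z2) n : Z2_seq (x + y) n = Z2_seq x n + Z2_seq y n.
Proof. by rewrite -[LHS]/(val (x + y) n) raddfD. Qed.

Lemma Z2_redP (x : Z2) n : Zpow2_red (Z2_seq x n.+1) = Z2_seq x n.
Proof. by case: x => x /= /asboolP. Qed.

End TwoAdicIntegers.

Section Pruefer.

(* Z/2^oo is Z[1/2]/Z. *)
Definition dyadic_pred : {pred rat} := fun x =>
  `[< exists k : nat, x * 2 ^+ k \is a Num.int >].

Fact dyadic_pred_zmod_closed : zmod_closed dyadic_pred.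
Proof.
split=> [|x y /asboolP[j xj] /asboolP[k yk]]; apply/asboolP.
  by exists 0%N; rewrite mul0r rpred0.
exists (j + k)%N; rewrite exprD mulrBl mulrA rpredB //.
  by rewrite rpredM // rpredX // rpred_nat.
by rewrite (mulrC (2 ^+ j)) mulrA rpredM // rpredX // rpred_nat.
Qed.
HB.instance Definition _ :=
  GRing.isZmodClosed.Build rat dyadic_pred dyadic_pred_zmod_closed.

Record dyadic := Dyadic { dyadic_rat :> rat; _ : dyadic_rat \in dyadic_pred }.

HB.instance Definition _ := [isSub for dyadic_rat].
HB.instance Definition _ := [Choice of dyadic by <:].
HB.instance Definition _ := [SubChoice_isSubZmodule of dyadic by <:].

Definition dyadic_int : {pred dyadic} := fun x => (val x \is a Num.int).

Fact dyadic_int_zmod_closed : zmod_closed dyadic_int.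
Proof.
split=> [|x y]; rewrite !unfold_in; first exact: rpred0.
by move=> xi yi; rewrite raddfB; apply: rpredB.
Qed.
HB.instance Definition _ :=
  GRing.isZmodClosed.Build dyadic dyadic_int dyadic_int_zmod_closed.

Definition pruefer : zmodType := quot dyadic_int.

End Pruefer.

Record vfunctor := VFunctor {
  fobj :> vectType 'F_2 -> zmodType;
  fmap : forall U V : vectType 'F_2, 'Hom(U, V) -> {additive fobj U -> fobj V};
  fmap1 : forall (V : vectType 'F_2) (x : fobj V), fmap (\1%VF : 'End(V)) x = x;
  fmap_comp : forall (U V W : vectType 'F_2) (g : 'Hom(V, W)) (f : 'Hom(U, V))
    (x : fobj U), fmap (g \o f)%VF x = fmap g (fmap f x)
}.

Record nattrans (F G : vfunctor) := NatTrans {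
  ncomp :> forall V : vectType 'F_2, {additive F V -> G V};
  naturality : forall (U V : vectType 'F_2) (f : 'Hom(U, V)) (x : F U),
    ncomp V (fmap F f x) = fmap G f (ncomp U x)
}.

(* Epimorphisms of functors are the pointwise surjective transformations. *)
Definition nat_surjective F G (t : nattrans F G) : Prop :=
  forall (V : vectType 'F_2) (y : G V), exists x : F V, t V x = y.

Definition nat_iso F G (t : nattrans F G) : Prop :=
  exists s : nattrans G F, forall V : vectType 'F_2,
    cancel (t V) (s V) /\ cancel (s V) (t V).

Section TensorFunctor.
Context (A : zmodType) (F : vfunctor).

Definition tens_map (U V : vectType 'F_2) (f : 'Hom(U, V)) :
    {additive tensor A (F U) -> tensor A (F V)} :=
  tlift (h := fun a x => tens a (fmap F f x))
    (fun a a' x => tensDl a a' (fmap F f x))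
    (fun a x x' => etrans (congr1 (tens a) (raddfD (fmap F f) x x'))
                     (tensDr a (fmap F f x) (fmap F f x'))).

Lemma tens_mapE (U V : vectType 'F_2) (f : 'Hom(U, V)) a x :
  tens_map f (tens a x) = tens a (fmap F f x).
Proof. exact: tliftE. Qed.

Fact tens_map1 (V : vectType 'F_2) (x : tensor A (F V)) :
  tens_map (\1%VF : 'End(V)) x = x.
Proof.
apply: (@eq_tensor_additive _ _ _ (tens_map \1%VF) idfun) => a y.
by rewrite tens_mapE fmap1.
Qed.

Fact tens_map_comp (U V W : vectType 'F_2) (g : 'Hom(V, W)) (f : 'Hom(U, V))
    (x : tensor A (F U)) :
  tens_map (g \o f)%VF x = tens_map g (tens_map f x).
Proof.
apply: (@eq_tensor_additive _ _ _ (tens_map _) (tens_map g \o tens_map f)) => a y.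
rewrite -[RHS]/(tens_map g (tens_map f (tens a y))).
by rewrite !tens_mapE fmap_comp.
Qed.

Definition tensorf : vfunctor := VFunctor tens_map1 tens_map_comp.

End TensorFunctor.

Section Dual.

Definition dualv (V : vectType 'F_2) : vectType 'F_2 := 'Hom(V, ('F_2)^o).

Fact transpose_linear (U V : vectType 'F_2) (f : 'Hom(U, V)) :
  linear (fun phi : dualv V => (phi \o f)%VF : dualv U).
Proof. by move=> a phi psi; rewrite comp_lfunDl comp_lfunZl. Qed.

Definition transpose (U V : vectType 'F_2) (f : 'Hom(U, V)) :
    'Hom(dualv V, dualv U) :=
  linfun (HB.pack_for {linear dualv V -> dualv U}
    (fun phi : dualv V => (phi \o f)%VF : dualv U)
    (GRing.isLinear.Build _ _ _ _ _ (transpose_linear f))).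

Lemma transposeE (U V : vectType 'F_2) (f : 'Hom(U, V)) phi :
  transpose f phi = (phi \o f)%VF.
Proof. by rewrite /transpose lfunE. Qed.

Lemma transpose1 (V : vectType 'F_2) : transpose (\1%VF : 'End(V)) = \1%VF.
Proof. by apply/lfunP => phi; rewrite transposeE comp_lfun1r id_lfunE. Qed.

Lemma transpose_comp (U V W : vectType 'F_2) (g : 'Hom(V, W)) (f : 'Hom(U, V)) :
  transpose (g \o f)%VF = (transpose f \o transpose g)%VF.
Proof. by apply/lfunP => phi; rewrite comp_lfunE !transposeE comp_lfunA. Qed.

Context (F : vfunctor).

Definition Dobj (V : vectType 'F_2) : zmodType := addhom (F (dualv V)) pruefer.

Definition Dmap_fun (U V : vectType 'F_2) (f : 'Hom(U, V)) (a : Dobj U) : Dobj V :=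
  mkaddhom (a \o fmap F (transpose f)).

Fact Dmap_is_zmod_morphism (U V : vectType 'F_2) (f : 'Hom(U, V)) :
  zmod_morphism (Dmap_fun f).
Proof. by move=> a b; apply: addhomP => x; rewrite [RHS]addhomBE; apply: addhomBE. Qed.
HB.instance Definition _ (U V : vectType 'F_2) (f : 'Hom(U, V)) :=
  GRing.isZmodMorphism.Build (Dobj U) (Dobj V) (Dmap_fun f)
    (Dmap_is_zmod_morphism f).

Definition Dmap (U V : vectType 'F_2) (f : 'Hom(U, V)) :
  {additive Dobj U -> Dobj V} := Dmap_fun f.

Fact Dmap1 (V : vectType 'F_2) (a : Dobj V) : Dmap (\1%VF : 'End(V)) a = a.
Proof. by apply: addhomP => x; rewrite /= transpose1 fmap1. Qed.

Fact Dmap_comp (U V W : vectType 'F_2) (g : 'Hom(V, W)) (f : 'Hom(U, V))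
  (a : Dobj U) : Dmap (g \o f)%VF a = Dmap g (Dmap f a).
Proof. by apply: addhomP => x; rewrite /= transpose_comp fmap_comp. Qed.

Definition pdual : vfunctor := VFunctor Dmap1 Dmap_comp.

End Dual.

Section GroupRing.
Context (V : vectType 'F_2).

Definition groupring := {freeg V}.

HB.instance Definition _ := GRing.Zmodule.on groupring.

Definition gr_mul (x y : groupring) : groupring :=
  flift (fun u : V => flift (fun v : V => << u + v >> : groupring) y) x.
Definition gr_one : groupring := << 0 >>.

Lemma gr_mulU u v : gr_mul << u >> << v >> = << u + v >>.
Proof. by rewrite /gr_mul !fliftU. Qed.

Fact gr_mulDl : left_distributive gr_mul +%R.
Proof. by move=> x y z; rewrite /gr_mul raddfD. Qed.

Fact gr_mulBl x y z : gr_mul (x - y) z = gr_mul x z - gr_mul y z.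
Proof. by rewrite /gr_mul raddfB. Qed.

Fact gr_mul0l z : gr_mul 0 z = 0.
Proof. by rewrite /gr_mul raddf0. Qed.

Fact gr_mulC : commutative gr_mul.
Proof.
have mulUB u y z : gr_mul << u >> (y - z) = gr_mul << u >> y - gr_mul << u >> z.
  by rewrite /gr_mul !fliftU raddfB.
have mulU0 u : gr_mul << u >> 0 = 0 by rewrite /gr_mul !fliftU raddf0.
have mulUC u y : gr_mul << u >> y = gr_mul y << u >>.
  elim/freeg_ind: y => [|y z IHy IHz|v]; first by rewrite mulU0 gr_mul0l.
    by rewrite mulUB IHy IHz gr_mulBl.
  by rewrite !gr_mulU addrC.
have mulBr x y z : gr_mul x (y - z) = gr_mul x y - gr_mul x z.
  elim/freeg_ind: x => [|x x' IHx IHx'|u]; rewrite ?mulUB ?gr_mul0l ?subr0 //.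
  by rewrite !gr_mulBl IHx IHx' !opprD !opprK addrACA.
move=> x y; elim/freeg_ind: y => [|y z IHy IHz|v]; last by rewrite mulUC.
  by have := mulBr x 0 0; rewrite !subrr gr_mul0l.
by rewrite mulBr gr_mulBl IHy IHz.
Qed.

Fact gr_mulBr x y z : gr_mul x (y - z) = gr_mul x y - gr_mul x z.
Proof. by rewrite gr_mulC gr_mulBl !(gr_mulC x). Qed.

Fact gr_mul0r x : gr_mul x 0 = 0.
Proof. by rewrite gr_mulC gr_mul0l. Qed.

Fact gr_mulA : associative gr_mul.
Proof.
move=> x y z; elim/freeg_ind: x => [|x x' IHx IHx'|u]; first by rewrite !gr_mul0l.
  by rewrite !gr_mulBl IHx IHx'.
elim/freeg_ind: y => [|y y' IHy IHy'|v]; first by rewrite gr_mul0r !gr_mul0l gr_mul0r.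
  by rewrite gr_mulBr !gr_mulBl gr_mulBr IHy IHy'.
elim/freeg_ind: z => [|z z' IHz IHz'|w]; first by rewrite !gr_mul0r.
  by rewrite !gr_mulBr IHz IHz'.
by rewrite !gr_mulU addrA.
Qed.

Fact gr_mul1 : left_id gr_one gr_mul.
Proof.
move=> x; elim/freeg_ind: x => [|x y IHx IHy|u]; first by rewrite gr_mul0r.
  by rewrite gr_mulBr IHx IHy.
by rewrite gr_mulU add0r.
Qed.

Fact gr_one_neq0 : gr_one != 0.
Proof. by rewrite -(inj_eq (can_inj (@opprK _))) freegUN oppr0 freegU_eq0. Qed.

HB.instance Definition _ :=
  GRing.Zmodule_isComNzRing.Build groupring
    gr_mulA gr_mulC gr_mul1 gr_mulDl gr_one_neq0.

Lemma grU (u v : V) : (<< u >> : groupring) * << v >> = << u + v >>.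
Proof. exact: gr_mulU. Qed.

(* deg, the sum of the coefficients, is the augmentation Z[V] -> Z. *)
Definition aug_pred : {pred groupring} := fun x => deg x == 0.

Fact aug_pred_zmod_closed : zmod_closed aug_pred.
Proof.
split=> [|x y]; rewrite !unfold_in; first by rewrite deg0.
by move=> /eqP x0 /eqP y0; rewrite degB x0 y0 subr0.
Qed.
HB.instance Definition _ :=
  GRing.isZmodClosed.Build groupring aug_pred aug_pred_zmod_closed.

Record augI := AugI { augI_val :> groupring; _ : augI_val \in aug_pred }.

HB.instance Definition _ := [isSub for augI_val].
HB.instance Definition _ := [Choice of augI by <:].
HB.instance Definition _ := [SubChoice_isSubZmodule of augI by <:].

(* The image of the n-fold product map from the n-th tensor power of augI, for
   n > 0: integer coefficients are absorbed by the factors. *)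
Definition augpow_pred n : {pred augI} := fun x =>
  `[< exists s : seq (n.-tuple augI),
      val x = \sum_(t <- s) \prod_(a <- t) val a >].

Fact augpow_pred_zmod_closed n : zmod_closed (augpow_pred n.+1).
Proof.
have PN x : x \in augpow_pred n.+1 -> - x \in augpow_pred n.+1.
  move=> /asboolP[s xs]; apply/asboolP.
  exists [seq [tuple of - thead t :: behead t] | t <- s].
  have -> : val (- x) = - val x by exact: raddfN.
  rewrite xs big_map -sumrN; apply: eq_bigr => t _.
  by rewrite {1}(tuple_eta t) !big_cons raddfN mulNr.
split=> [|x y /asboolP[s xs] /PN /asboolP[s' ys]]; apply/asboolP.
  by exists [::]; rewrite big_nil raddf0.
by exists (s ++ s'); rewrite big_cat -xs -ys raddfD.
Qed.
HB.instance Definition _ n :=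
  GRing.isZmodClosed.Build augI (augpow_pred n.+1) (augpow_pred_zmod_closed n).

Definition Robj n : zmodType := quot (augpow_pred n.+1).

Definition Rpi n : {additive augI -> Robj n} := qpi (augpow_pred n.+1).

Lemma Rpi_surj n (y : Robj n) : exists x, Rpi n x = y.
Proof. exact: qpi_surj. Qed.

Lemma Rpi_eq0 n x : (Rpi n x == 0) = (x \in augpow_pred n.+1).
Proof. exact: qpi_eq0. Qed.

End GroupRing.

Section GroupRingMap.
Context (U V : vectType 'F_2) (f : 'Hom(U, V)).

Definition gr_map (x : groupring U) : groupring V :=
  flift (fun u : U => << f u >> : groupring V) x.

Lemma gr_mapU u : gr_map << u >> = << f u >>.
Proof. exact: fliftU. Qed.

Fact gr_map_is_zmod_morphism : zmod_morphism gr_map.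
Proof. exact: raddfB. Qed.
HB.instance Definition _ :=
  GRing.isZmodMorphism.Build (groupring U) (groupring V) gr_map
    gr_map_is_zmod_morphism.

Fact gr_map_is_monoid_morphism : monoid_morphism gr_map.
Proof.
split=> [|x y]; first by rewrite [LHS]gr_mapU linear0.
elim/freeg_ind: x => [|x x' IHx IHx'|u]; first by rewrite raddf0 !mul0r raddf0.
  by rewrite raddfB !mulrBl raddfB /= IHx IHx'.
elim/freeg_ind: y => [|y y' IHy IHy'|v]; first by rewrite raddf0 !mulr0 raddf0.
  by rewrite raddfB !mulrBr raddfB /= IHy IHy'.
by rewrite grU !gr_mapU grU linearD.
Qed.
HB.instance Definition _ :=
  GRing.isMonoidMorphism.Build (groupring U) (groupring V) gr_map
    gr_map_is_monoid_morphism.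

Lemma deg_gr_map x : deg (gr_map x) = deg x.
Proof.
elim/freeg_ind: x => [|x y IHx IHy|u]; first by rewrite raddf0 !deg0.
  by rewrite raddfB !degB /= IHx IHy.
by rewrite gr_mapU !degU.
Qed.

Fact aug_map_subproof (x : augI U) : gr_map (val x) \in @aug_pred V.
Proof. by rewrite unfold_in deg_gr_map; case: x. Qed.

Definition aug_map_fun (x : augI U) : augI V := AugI (aug_map_subproof x).

Fact aug_map_is_zmod_morphism : zmod_morphism aug_map_fun.
Proof. by move=> x y; apply: val_inj; rewrite /= !raddfB. Qed.
HB.instance Definition _ :=
  GRing.isZmodMorphism.Build (augI U) (augI V) aug_map_fun
    aug_map_is_zmod_morphism.

Definition aug_map : {additive augI U -> augI V} := aug_map_fun.

Lemma aug_map_pow n x : x \in @augpow_pred U n -> aug_map x \in @augpow_pred V n.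
Proof.
move=> /asboolP[s xs]; apply/asboolP; exists [seq map_tuple aug_map t | t <- s].
rewrite [LHS]/= [augI_val x]xs raddf_sum big_map; apply: eq_bigr => t _.
by rewrite /= (rmorph_prod gr_map) big_map.
Qed.

Fact Rmap_subproof n (x : augI U) : x \in @augpow_pred U n.+1 ->
  (Rpi V n \o aug_map : {additive _ -> _}) x = 0.
Proof. by move=> /aug_map_pow xn; apply/eqP; rewrite Rpi_eq0. Qed.

Definition Rmap n : {additive Robj U n -> Robj V n} := qlift (@Rmap_subproof n).

Lemma Rmap_pi n x : Rmap n (Rpi U n x) = Rpi V n (aug_map x).
Proof. exact: qlift_pi. Qed.

End GroupRingMap.

Section PassiFunctors.

Fact aug_map1 (V : vectType 'F_2) (x : augI V) : aug_map (\1%VF : 'End(V)) x = x.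
Proof.
apply: val_inj => /=; elim/freeg_ind: (augI_val x) => [|y z IHy IHz|v].
- by rewrite raddf0.
- by rewrite raddfB /= IHy IHz.
- by rewrite gr_mapU id_lfunE.
Qed.

Fact aug_map_comp (U V W : vectType 'F_2) (g : 'Hom(V, W)) (f : 'Hom(U, V))
  (x : augI U) : aug_map (g \o f)%VF x = aug_map g (aug_map f x).
Proof.
apply: val_inj => /=; elim/freeg_ind: (augI_val x) => [|y z IHy IHz|v].
- by rewrite !raddf0.
- by rewrite !raddfB /= IHy IHz.
- by rewrite !gr_mapU comp_lfunE.
Qed.

Definition barP : vfunctor := VFunctor aug_map1 aug_map_comp.

Definition barPZ2 : vfunctor := tensorf Z2 barP.

Context (n : nat).

Fact Rmap1 (V : vectType 'F_2) (x : Robj V n) : Rmap (\1%VF : 'End(V)) n x = x.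
Proof. by have [y <-] := Rpi_surj x; rewrite Rmap_pi aug_map1. Qed.

Fact Rmap_comp (U V W : vectType 'F_2) (g : 'Hom(V, W)) (f : 'Hom(U, V))
  (x : Robj U n) : Rmap (g \o f)%VF n x = Rmap g n (Rmap f n x).
Proof. by have [y <-] := Rpi_surj x; rewrite !Rmap_pi aug_map_comp. Qed.

Definition Rn : vfunctor := VFunctor Rmap1 Rmap_comp.

Lemma addvv_F2 (V : vectType 'F_2) (v : V) : v + v = 0.
Proof. by rewrite -mulr2n -scaler_nat (_ : 2%:R = 0) ?scale0r //; apply: val_inj. Qed.

Fact aug_red_subproof (V : vectType 'F_2) (x : groupring V) :
  x - (deg x)%:~R \in @aug_pred V.
Proof. by rewrite unfold_in degB raddfMz /= degU mulrzz mul1r subrr. Qed.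

Definition aug_red (V : vectType 'F_2) (x : groupring V) : augI V :=
  AugI (aug_red_subproof x).

Fact aug_red_is_zmod_morphism (V : vectType 'F_2) : zmod_morphism (@aug_red V).
Proof.
by move=> x y; apply: val_inj; rewrite /= degB intrB !opprD !opprK addrACA.
Qed.
HB.instance Definition _ (V : vectType 'F_2) :=
  GRing.isZmodMorphism.Build (groupring V) (augI V) (@aug_red V)
    (@aug_red_is_zmod_morphism V).

Lemma aug_redK (V : vectType 'F_2) (x : augI V) : aug_red (val x) = x.
Proof.
by apply: val_inj; case: x => x x0 /=; rewrite (eqP (x0 : deg x == 0)) subr0.
Qed.

(* (v - 1)^2 = -2 (v - 1), whence 2^n kills R^n. *)
Lemma augU_exp (V : vectType 'F_2) (v : V) (e := (<< v >> : groupring V) - 1) k :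
  e ^+ k.+1 = (-1) ^+ k * e *+ 2 ^ k.
Proof.
have ee : e * e = - e *+ 2.
  have vv : (<< v >> : groupring V) * << v >> = 1 by rewrite grU addvv_F2.
  rewrite /e mulrBl mulrBr !mul1r mulr1 vv mulr2n !opprD !opprK.
  by rewrite addrACA (addrC (- _ : groupring V) 1) addrA.
elim: k => [|k IHk]; first by rewrite expr1 expr0 mulr1n mul1r.
by rewrite exprS IHk mulrnAr mulrCA ee exprS expnS mulrnA mulN1r mulrnAr mulrN mulNr.
Qed.

Lemma aug_killed (V : vectType 'F_2) (x : augI V) :
  x *+ 2 ^ n \in @augpow_pred V n.+1.
Proof.
rewrite -(aug_redK x); elim/freeg_ind: (val x) => [|y z IHy IHz|v].
- by rewrite raddf0 mul0rn rpred0.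
- by rewrite raddfB mulrnBl rpredB.
set a := aug_red << v >> *+ 2 ^ n.
suff : (if odd n then - a else a) \in @augpow_pred V n.+1.
  by case: (odd n); rewrite ?rpredN.
apply/asboolP; exists [:: [tuple of nseq n.+1 (aug_red << v >>)]].
rewrite big_seq1 big_nseq iter_mulr_1 /= degU augU_exp -signr_odd.
have va : val a = ((<< v >> : groupring V) - 1) *+ 2 ^ n by rewrite raddfMn /= degU.
by case: (odd n); rewrite ?expr1 ?expr0 ?mulN1r ?mul1r ?mulNrn -va // -raddfN.
Qed.

Lemma Rn_killed (V : vectType 'F_2) (y : Rn V) : y *+ 2 ^ n = 0.
Proof.
have [x <-] := Rpi_surj y.
by apply/eqP; rewrite -raddfMn Rpi_eq0 aug_killed.
Qed.

Lemma Rn_mod (V : vectType 'F_2) (y : Rn V) k : y *+ (k %% 2 ^ n.+1) = y *+ k.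
Proof.
rewrite [in RHS](divn_eq k (2 ^ n.+1)) mulrnDr mulnC mulrnA expnS mulnC mulrnA.
by rewrite Rn_killed !mul0rn add0r.
Qed.

(* 2^n kills R^n, so Z_2 acts on R^n through Z/2^(n+1), which is component n
   of Z2_seq. *)
Definition Z2_act (V : vectType 'F_2) (z : Z2) (y : Rn V) : Rn V :=
  y *+ (Z2_seq z n : 'Z_(2 ^ n.+1)).

Fact Z2_actDl (V : vectType 'F_2) (z z' : Z2) (y : Rn V) :
  Z2_act (z + z') y = Z2_act z y + Z2_act z' y.
Proof.
rewrite /Z2_act Z2D -mulrnDr -[RHS]Rn_mod -val_Zpow2_nat natrD.
by rewrite !natr_Zp.
Qed.

Fact Z2_actDr (V : vectType 'F_2) (z : Z2) (y y' : Rn V) :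
  Z2_act z (y + y') = Z2_act z y + Z2_act z y'.
Proof. exact: mulrnDl. Qed.

Lemma Z2_act1 (V : vectType 'F_2) (y : Rn V) : Z2_act 1 y = y.
Proof. by []. Qed.

Definition Rproj_fun (V : vectType 'F_2) : {additive barPZ2 V -> Rn V} :=
  tlift (h := fun z x => Z2_act z (Rpi V n x))
    (fun z z' x => Z2_actDl z z' (Rpi V n x))
    (fun z x x' => etrans (congr1 (Z2_act z) (raddfD (Rpi V n) x x'))
                     (Z2_actDr z (Rpi V n x) (Rpi V n x'))).

Lemma Rproj_tens (V : vectType 'F_2) (z : Z2) (x : augI V) :
  Rproj_fun V (tens z x) = Z2_act z (Rpi V n x).
Proof. exact: tliftE. Qed.

Fact Rproj_natural (U V : vectType 'F_2) (f : 'Hom(U, V)) (x : barPZ2 U) :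
  Rproj_fun V (fmap barPZ2 f x) = fmap Rn f (Rproj_fun U x).
Proof.
apply: (@eq_tensor_additive _ _ _ (Rproj_fun V \o @tens_map Z2 barP U V f)
          (Rmap f n \o Rproj_fun U)) => z y.
rewrite -[LHS]/(Rproj_fun V (@tens_map Z2 barP U V f (tens z y))) tens_mapE Rproj_tens.
rewrite -[RHS]/(Rmap f n (Rproj_fun U (tens z y))) Rproj_tens.
by rewrite /Z2_act raddfMn Rmap_pi.
Qed.

Definition Rproj : nattrans barPZ2 Rn := NatTrans Rproj_natural.

Lemma Rproj_surjective : nat_surjective Rproj.
Proof.
move=> V y; have [x <-] := Rpi_surj y.
by exists (tens (1 : Z2) x); rewrite [LHS]Rproj_tens Z2_act1.
Qed.

End PassiFunctors.

(* Main.v *)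
Require Import Defs.
From HB Require Import structures.
From mathcomp Require Import all_boot all_order all_algebra.
From mathcomp Require Import boolp functions.
From mathcomp Require Import freeg zify ring.

(** Let I(V) be the augmentation ideal of Z[V], so that R^n(V) = I(V)/I(V)^(n+1).
    Everything rests on the integral pairing

      chi : Z[V] x Z[V^#] -> Z,   chi([v], [phi]) = (-1)^phi(v).

    For fixed phi, chi(-, [phi]) is a ring morphism Z[V] -> Z which is the
    augmentation modulo 2, hence maps I^(n+1) into 2^(n+1) Z; the same holds with
    the two sides exchanged. So every c in Z/2^oo killed by 2^(n+1) gives a natural
    transformation theta c : R^n -> D R^n, x |-> (y |-> chi(x, y) c).

    If v_i is a basis of V, the products e_S of the [v_i] - 1 for i in a nonempty
    set S span I(V), and the dual basis gives e*_T in I(V^#) likewise. The key fact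
    is that chi is diagonal in these families (chi_mon):

      chi(e_S, e*_T) = (-2)^|S| if S = T, and 0 otherwise.

    Moreover 2^m e_S lies in I^(n+1) as soon as m + |S| > n, because
    ([v] - 1)^2 = -2 ([v] - 1). When c has order exactly 2^(n+1) the two facts make
    theta c bijective: on the coefficient of e_S its kernel is the condition that
    2^(n+1-|S|) divides it, which already forces the term into I^(n+1)
    (theta_inj); and the value of a form h on e*_T is killed by 2^(n+1-|T|), hence
    is a multiple of 2^|T| c (theta_surj).

    It remains to see that every surjection f : Z_2 (x) I -> D R^n is
    theta c composed with the projection, for such a c. As D R^n is killed by 2^n,
    only f(1 (x) -) matters. By naturality along the lines F_2 -> V it is determined
    by the one number nat_const f in Z/2^oo: f([v] - 1)([phi] - 1) is nat_const f or
    0 according to phi(v) (nat_constE). Writing nat_const f as -2c, which is possible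
    since Z/2^oo is divisible, gives f = theta c o Rproj (nattrans_theta), and
    surjectivity of f at V = F_2 forces c to have order exactly 2^(n+1)
    (surj_nat_const). *)

Set Implicit Arguments.
Unset Strict Implicit.
Unset Printing Implicit Defensive.

Import Order.TTheory GRing.Theory Num.Theory.
Local Open Scope ring_scope.

Local Notation pt v := (<< v >> : groupring _).

(** * Powers of the augmentation ideal *)

Section AugmentationPowers.
Context (V : vectType 'F_2).
Implicit Types (x y z : groupring V) (v : V).

Lemma aug_predE x : (x \in @aug_pred V) = (deg x == 0).
Proof. by []. Qed.

(** The powers are described inside the group ring, rather than inside augI V, in
    order to multiply by arbitrary elements of Z[V]. *)
Definition gr_pow k : {pred groupring V} := fun x =>
  `[< exists s : seq (k.-tuple (augI V)), x = \sum_(t <- s) \prod_(a <- t) val a >].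

Lemma gr_powE k (a : augI V) : (val a \in gr_pow k) = (a \in @augpow_pred V k).
Proof. by []. Qed.

Lemma gr_powB k x y :
  x \in gr_pow k.+1 -> y \in gr_pow k.+1 -> x - y \in gr_pow k.+1.
Proof.
move=> /asboolP[s ->] /asboolP[s' ->]; apply/asboolP.
exists (s ++ [seq [tuple of - thead t :: behead t] | t <- s']).
rewrite big_cat big_map -sumrN; congr (_ + _); apply: eq_bigr => t _.
by rewrite {1}(tuple_eta t) !big_cons raddfN mulNr.
Qed.

Lemma gr_pow0 k : 0 \in gr_pow k.
Proof. by apply/asboolP; exists [::]; rewrite big_nil. Qed.

Lemma gr_powN k x : x \in gr_pow k.+1 -> - x \in gr_pow k.+1.
Proof. by rewrite -(sub0r x); apply: gr_powB; apply: gr_pow0. Qed.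

Lemma aug_predM x y : x \in @aug_pred V -> x * y \in @aug_pred V.
Proof.
move=> x0; suff E : deg (x * y) = deg x * deg y.
  by move: x0; rewrite !aug_predE E => /eqP->; rewrite mul0r.
move: x y {x0}; apply: freeg_ind => [|x x' Hx Hx'|u] y.
- by rewrite mul0r deg0 mul0r.
- by rewrite mulrBl !degB Hx Hx' mulrBl.
elim/freeg_ind: y => [|y y' Hy Hy'|v]; first by rewrite mulr0 deg0 mulr0.
  by rewrite mulrBr !degB Hy Hy' mulrBr.
by rewrite grU !degU.
Qed.

Lemma gr_powMr k x y : x \in gr_pow k.+1 -> x * y \in gr_pow k.+1.
Proof.
move=> /asboolP[s ->]; apply/asboolP.
exists [seq [tuple of AugI (aug_predM y (valP (thead t))) :: behead t] | t <- s].
rewrite big_map mulr_suml; apply: eq_bigr => t _.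
by rewrite {1}(tuple_eta t) !big_cons mulrAC.
Qed.

Lemma gr_powMz k x (m : int) : x \in gr_pow k.+1 -> x *~ m \in gr_pow k.+1.
Proof. by rewrite -mulrzr; apply: gr_powMr. Qed.

Lemma gr_pow_sum k (I : Type) (r : seq I) (P : pred I) (F : I -> groupring V) :
  (forall i, P i -> F i \in gr_pow k.+1) -> \sum_(i <- r | P i) F i \in gr_pow k.+1.
Proof.
move=> FP; elim/big_rec: _ => [|i x Pi xP]; first exact: gr_pow0.
by rewrite -(opprK x); apply: gr_powB; [apply: FP | apply: gr_powN].
Qed.

Lemma gr_pow1 x : x \in @aug_pred V -> x \in gr_pow 1.
Proof.
by move=> x0; apply/asboolP; exists [:: [tuple AugI x0]]; rewrite !big_seq1.
Qed.

Lemma gr_powS k x y : x \in gr_pow k -> y \in @aug_pred V -> x * y \in gr_pow k.+1.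
Proof.
move=> /asboolP[s ->] y0; apply/asboolP; exists [seq cons_tuple (AugI y0) t | t <- s].
rewrite big_map mulr_suml; apply: eq_bigr => t _.
by rewrite big_cons mulrC.
Qed.

Definition aug_gen v : groupring V := pt v - 1.

Lemma aug_gen_pred v : aug_gen v \in @aug_pred V.
Proof. by rewrite aug_predE degB !degU subrr. Qed.

Lemma aug_gen2 v : aug_gen v *+ 2 = - (aug_gen v * aug_gen v).
Proof. by rewrite -expr2 (augU_exp v 1) expr1 mulN1r mulNrn opprK. Qed.

Section Monomials.
Context (d : nat) (v_ : 'I_d -> V).

Definition aug_mon (S : {set 'I_d}) : groupring V := \prod_(i in S) aug_gen (v_ i).

Lemma aug_monD1 i (S : {set _}) : i \in S -> aug_mon S = aug_gen (v_ i) * aug_mon (S :\ i).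
Proof. by move=> iS; rewrite /aug_mon (big_setD1 i). Qed.

Lemma aug_mon_pred S : S != set0 -> aug_mon S \in @aug_pred V.
Proof.
by case/set0Pn=> i /aug_monD1->; apply/aug_predM/aug_gen_pred.
Qed.

(** Each factor 2 can be traded for one more factor [v_i] - 1 with i in S, up to
    sign, since 2 ([v] - 1) = - ([v] - 1)^2. *)
Lemma aug_mon_pow n S m : S != set0 -> (n < m + #|S|)%N ->
  aug_mon S *+ 2 ^ m \in gr_pow n.+1.
Proof.
elim: n S m => [|n IHn] S m S0 nS.
  by rewrite pmulrn; apply/gr_powMz/gr_pow1/aug_mon_pred.
have [i iS] := set0Pn _ S0.
have monS : aug_mon S = aug_mon (S :\ i) * aug_gen (v_ i).
  by rewrite mulrC -aug_monD1.
case: m nS => [|m] nS.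
  have := cardsD1 i S; rewrite iS => cS.
  rewrite monS; apply: gr_powS (aug_gen_pred _).
  have -> : aug_mon (S :\ i) = aug_mon (S :\ i) *+ 2 ^ 0 by [].
  by apply: IHn; [rewrite -card_gt0 | ]; lia.
have -> : aug_mon S *+ 2 ^ m.+1 = - (aug_mon S *+ 2 ^ m * aug_gen (v_ i)).
  by rewrite expnS mulrnA monS -mulrnAr aug_gen2 mulrN mulNrn mulrA mulrnAl.
by apply/gr_powN/gr_powS; [apply: IHn => //; lia | apply: aug_gen_pred].
Qed.

(** [v] is a product of factors [v_i] = 1 + ([v_i] - 1); expanding it gives a
    combination of monomials. The empty monomial 1 is the only one of nonzero
    degree, so its coefficient in an element of degree 0 vanishes. *)
Lemma aug_mon_span (gen : forall v, exists S : {set 'I_d}, v = \sum_(i in S) v_ i) x :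
  x \in @aug_pred V ->
  exists a : {set 'I_d} -> int, x = \sum_(S | S != set0) aug_mon S *~ a S.
Proof.
move=> x0.
have [a xE] : exists a : {set 'I_d} -> int, x = \sum_S aug_mon S *~ a S.
  elim/freeg_ind: x {x0} => [|x y [a ->] [b ->]|v].
  - by exists (fun=> 0); rewrite big1 // => S _; rewrite mulr0z.
  - exists (fun S => a S - b S); rewrite -sumrB.
    by apply: eq_bigr => S _; rewrite mulrzBr.
  (* [v] is the sum of all monomials over subsets of T. *)
  have [T ->] := gen v; exists (fun S : {set _} => if S \subset T then 1 else 0).
  have -> : pt (\sum_(i in T) v_ i) = \prod_(i in T) pt (v_ i).
    elim/big_rec2: _ => // i x y _ <-; exact: esym (grU _ _).
  have -> : \prod_(i in T) pt (v_ i) =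
      \prod_i ((if i \in T then aug_gen (v_ i) else 0) + 1).
    by rewrite big_mkcond; apply: eq_bigr => i _; case: ifP; rewrite ?subrK ?add0r.
  rewrite bigA_distr; apply: eq_bigr => S _.
  rewrite -big_mkcond /=; case: subsetP => [ST|/subsetP/subsetPn[i iS iT]].
    by apply: eq_bigr => i /ST ->.
  by rewrite mulr0z (bigD1 i) //= (negPf iT) mul0r.
exists a; move: x0; rewrite aug_predE xE raddf_sum (bigD1 set0) //=.
rewrite big1 => [|S S0]; last first.
  by rewrite raddfMz [X in X *~ _](eqP (aug_mon_pred S0)) mul0rz.
rewrite /aug_mon big_set0 addr0 raddfMz /= degU mulrzz mul1r => /eqP a0.
by rewrite (bigD1 set0) //= a0 mulr0z add0r.
Qed.

End Monomials.

Lemma aug_red_val x :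
  x \in @aug_pred V -> val (aug_red x) = x.
Proof. by move/eqP=> x0; rewrite /= x0 subr0. Qed.

Definition aug_pt v : augI V := aug_red (pt v).

Lemma val_aug_pt v : val (aug_pt v) = aug_gen v.
Proof. by rewrite /= degU. Qed.

Lemma aug_pt0 : aug_pt (0 : V) = 0.
Proof. by apply: val_inj; rewrite val_aug_pt /aug_gen subrr. Qed.

Lemma aug_ind (P : augI V -> Prop) :
  P 0 -> (forall a b, P a -> P b -> P (a - b)) -> (forall v, P (aug_pt v)) ->
  forall a, P a.
Proof.
move=> P0 PB Pv a; rewrite -(aug_redK a); elim/freeg_ind: (val a) => [|y z|v].
- by rewrite raddf0.
- by rewrite raddfB; apply: PB.
- exact: Pv.
Qed.

End AugmentationPowers.

Lemma aug_map_red (U V : vectType 'F_2) (g : 'Hom(U, V)) x :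
  aug_map g (aug_red x) = aug_red (gr_map g x).
Proof. by apply: val_inj; rewrite /= raddfB raddfMz /= gr_mapU linear0 deg_gr_map. Qed.

(** * Torsion in the group Z/2^oo *)

Lemma dvdz_exp_cancel k s (a : int) : (2 ^+ k %| a * (- 2) ^+ s)%Z -> (2 ^+ (k - s) %| a)%Z.
Proof.
rewrite !dvdzE abszM !abszX => /= ks.
have [les|lts] := leqP s k; last by rewrite (_ : (k - s = 0)%N) ?dvd1z //; lia.
by rewrite -(@dvdn_pmul2r (2 ^ s)) ?expn_gt0 // -expnD subnK.
Qed.

Section PrueferTorsion.
Implicit Types (j m : int) (k n : nat) (c y : pruefer).

Fact dyadic_frac_subproof j k : j%:~R / 2 ^+ k \in dyadic_pred.
Proof. by apply/asboolP; exists k; rewrite divfK ?expf_neq0. Qed.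

Definition pfrac k j : pruefer := qpi dyadic_int (Dyadic (dyadic_frac_subproof j k)).

Fact pfrac_is_zmod_morphism k : zmod_morphism (pfrac k).
Proof.
move=> i j; rewrite /pfrac -raddfB; congr (qpi _ _); apply: val_inj.
by rewrite [RHS]raddfB /=; rewrite intrB mulrBl.
Qed.
HB.instance Definition _ k :=
  GRing.isZmodMorphism.Build int pruefer (pfrac k) (pfrac_is_zmod_morphism k).

Lemma pfrac_eq0 k j : (pfrac k j == 0) = (2 ^+ k %| j)%Z.
Proof.
rewrite qpi_eq0 unfold_in /=.
have k0 : 2 ^+ k != 0 :> rat by rewrite expf_neq0.
apply/intrP/dvdzP => -[q qE]; exists q.
  have := congr1 ( *%R^~ (2 ^+ k)) qE; rewrite /= divfK // => jE.
  by apply: (@intr_inj rat); rewrite intrM jE rmorphXn.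
by rewrite qE intrM rmorphXn /= mulfK.
Qed.

Lemma pfrac_killed k j : pfrac k j *+ 2 ^ k = 0.
Proof.
apply/eqP; rewrite -raddfMn pfrac_eq0; apply/dvdzP; exists j.
by rewrite -[LHS]mulr_natr natrX.
Qed.

Lemma pfrac_unit k : pfrac k.+1 1 *+ 2 ^ k != 0.
Proof.
by rewrite -raddfMn pfrac_eq0 natrX dvdzE !abszX dvdn_Pexp2l ?ltnn.
Qed.

Lemma pfrac_torsion k y : y *+ 2 ^ k = 0 -> exists j, y = pfrac k j.
Proof.
have [r <-] := qpi_surj y; rewrite -raddfMn => /eqP; rewrite qpi_eq0 unfold_in.
rewrite raddfMn /= => /intrP[j jE]; exists j; congr (qpi _ _); apply: val_inj => /=.
by rewrite -jE -[_ *+ (2 ^ k)]mulr_natr natrX mulfK // expf_neq0.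
Qed.

Lemma pruefer_half c : exists c', c' *+ 2 = c.
Proof.
have [r <-] := qpi_surj c.
have r2 : val r / 2 \in dyadic_pred.
  have /asboolP[k rk] := valP r; apply/asboolP; exists k.+1.
  by rewrite exprS mulrA divfK.
exists (qpi _ (Dyadic r2)); rewrite -raddfMn; congr (qpi _ _); apply: val_inj.
by rewrite raddfMn /= -[LHS]mulr_natr divfK.
Qed.

Lemma mulz_dvd_eq0 n c m : c *+ 2 ^ n.+1 = 0 -> (2 ^+ n.+1 %| m)%Z -> c *~ m = 0.
Proof.
by move=> c0 /dvdzP[q ->]; rewrite mulrC mulrzA -natrX natz -pmulrn c0 mul0rz.
Qed.

Section ExactOrder.
Context (n : nat) (c : pruefer).
Hypotheses (c0 : c *+ 2 ^ n.+1 = 0) (cN0 : c *+ 2 ^ n != 0).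

Lemma exact_order_frac : exists2 u, c = pfrac n.+1 u & coprimez u (2 ^+ n.+1).
Proof.
have [u cE] := pfrac_torsion c0; exists u => //.
have uN : ~~ (2 %| u)%Z.
  apply: contra cN0 => /dvdzP[q uq]; rewrite cE -raddfMn pfrac_eq0.
  by apply/dvdzP; exists q; rewrite uq -[_ *+ (2 ^ n)]mulr_natr natrX -mulrA -exprS.
by apply: coprimezXr; rewrite coprimezE coprimen2; move: uN; rewrite dvdzE dvdn2 negbK.
Qed.

Lemma exact_order_dvd m : c *~ m = 0 -> (2 ^+ n.+1 %| m)%Z.
Proof.
have [u -> cu] := exact_order_frac; rewrite -raddfMz => /eqP.
by rewrite pfrac_eq0 mulrzz Gauss_dvdzr // coprimez_sym.
Qed.

Lemma exact_order_gen y : y *+ 2 ^ n.+1 = 0 -> exists m, y = c *~ m.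
Proof.
move=> /pfrac_torsion[j ->]; have [u -> /coprimezP[[a b] /= ab]] := exact_order_frac.
exists (j * a); apply/eqP; rewrite -subr_eq0 -raddfMz -raddfB pfrac_eq0 mulrzz.
have abE : 1 - a * u = b * 2 ^+ n.+1 by apply/eqP; rewrite subr_eq addrC ab.
apply/dvdzP; exists (j * b); rewrite -mulrA -abE; ring.
Qed.

(** With n.+1 - s truncated at 0, this also covers s > n.+1, where y = 0. *)
Lemma exact_order_gen_exp s y : y *+ 2 ^ (n.+1 - s) = 0 ->
  exists a, y = c *~ (a * (- 2) ^+ s).
Proof.
move=> ys; have [les|lts] := leqP s n.+1; last first.
  have y0 : y = 0 by rewrite -ys (_ : (n.+1 - s = 0)%N) //; lia.
  by exists 0; rewrite y0 mul0r.
have [w yE] : exists w, y = c *~ w.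
  by apply: exact_order_gen; rewrite -(subnK les) expnD mulrnA ys mul0rn.
have /exact_order_dvd : c *~ (w * 2 ^+ (n.+1 - s)) = 0.
  by rewrite mulrzA -yE -ys -natrX natz -pmulrn.
have -> : 2 ^+ n.+1 = 2 ^+ s * 2 ^+ (n.+1 - s) :> int by rewrite -exprD subnKC.
rewrite dvdz_mul2r ?expf_neq0 // => /dvdzP[q wE].
exists (q * (-1) ^+ s); rewrite yE wE -mulrA -exprMn; congr (c *~ (_ * _ ^+ _)).
Qed.

End ExactOrder.

End PrueferTorsion.

(** * The sign pairing between Z[V] and Z[V^#] *)

Section SignCharacter.

Definition sgnF (a : 'F_2) : int := (-1) ^+ (a != 0).

Lemma sgnFD a b : sgnF (a + b) = sgnF a * sgnF b.
Proof. by move: a b => [[|[|[]]] //] ? [[|[|[]]] //] ?. Qed.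

Context (V : vectType 'F_2) (chr : V -> 'F_2).
Hypothesis chrD : {morph chr : u v / u + v}.

Definition gr_sgn : {additive groupring V -> int} := flift (fun v => sgnF (chr v)).

Lemma gr_sgnU v : gr_sgn << v >> = sgnF (chr v).
Proof. exact: fliftU. Qed.

Lemma gr_sgnM x y : gr_sgn (x * y) = gr_sgn x * gr_sgn y.
Proof.
elim/freeg_ind: x => [|x x' IHx IHx'|u]; first by rewrite mul0r raddf0 mul0r.
  by rewrite mulrBl !raddfB /= IHx IHx' mulrBl.
elim/freeg_ind: y => [|y y' IHy IHy'|v]; first by rewrite mulr0 raddf0 mulr0.
  by rewrite mulrBr !raddfB /= IHy IHy' mulrBr.
by rewrite grU !gr_sgnU chrD sgnFD.
Qed.

Lemma gr_sgn_deg x : (2 %| gr_sgn x - deg x)%Z.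
Proof.
elim/freeg_ind: x => [|x y IHx IHy|v]; first by rewrite raddf0 deg0.
  by rewrite raddfB degB /= opprD addrACA -opprD rpredB.
by rewrite gr_sgnU degU /sgnF; case: (chr v != 0).
Qed.

Lemma gr_sgn_aug x : x \in @aug_pred V -> (2 %| gr_sgn x)%Z.
Proof. by move/eqP=> x0; have := gr_sgn_deg x; rewrite x0 subr0. Qed.

Lemma gr_sgn_prod (s : seq (augI V)) : (2 ^+ size s %| gr_sgn (\prod_(a <- s) val a))%Z.
Proof.
elim: s => [|a s IHs]; first by rewrite expr0 dvd1z.
by rewrite big_cons gr_sgnM exprS dvdz_mul // gr_sgn_aug // (valP a).
Qed.

(** A ring morphism to Z that agrees with the augmentation modulo 2 sends I into
    2 Z, hence I^k into 2^k Z. *)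
Lemma gr_sgn_pow k x : x \in gr_pow k -> (2 ^+ k %| gr_sgn x)%Z.
Proof.
move=> /asboolP[s ->]; rewrite raddf_sum rpred_sum // => t _ /=.
by have := gr_sgn_prod t; rewrite size_tuple.
Qed.

Lemma gr_sgn_mon d (v_ : 'I_d -> V) S :
  gr_sgn (aug_mon v_ S) = \prod_(i in S) (sgnF (chr (v_ i)) - 1).
Proof.
have sgn1 : gr_sgn 1 = 1.
  have chr0 : chr 0 = 0 by apply: (addrI (chr 0)); rewrite -chrD !addr0.
  by rewrite [LHS]gr_sgnU chr0.
rewrite /aug_mon (big_morph _ gr_sgnM sgn1); apply: eq_bigr => i _.
by rewrite raddfB sgn1 /= gr_sgnU.
Qed.

End SignCharacter.

Section SignPairing.
Context (V : vectType 'F_2).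
Implicit Types (x : groupring V) (y : groupring (dualv V)) (v : V) (phi : dualv V).

Definition chi x : {additive groupring (dualv V) -> int} :=
  flift (fun phi => gr_sgn (fun v : V => phi v) x).

Lemma chiU x phi : chi x << phi >> = gr_sgn (fun v : V => phi v) x.
Proof. exact: fliftU. Qed.

(** The roles of V and V^# in chi can be exchanged; this gives additivity and
    divisibility in the first variable. *)
Lemma chi_sym x y :
  chi x y = flift (fun v => gr_sgn (fun phi : dualv V => phi v) y) x.
Proof.
elim/freeg_ind: y => [|y y' IHy IHy'|phi].
- rewrite raddf0; elim/freeg_ind: x => [|x x' IHx IHx'|v]; first by rewrite raddf0.
    by rewrite raddfB /= -IHx -IHx' subrr.
  by rewrite fliftU raddf0.
- rewrite raddfB /= IHy IHy'; elim/freeg_ind: x {IHy IHy'} => [|x x' IHx IHx'|v].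
  + by rewrite !raddf0 subr0.
  + by rewrite !raddfB /= -IHx -IHx' !opprD !opprK addrACA.
  + by rewrite !fliftU raddfB.
rewrite chiU; apply: eq_freeg_additive => v.
by rewrite gr_sgnU [RHS]fliftU [RHS]gr_sgnU.
Qed.

Lemma chiBl x x' y : chi (x - x') y = chi x y - chi x' y.
Proof. by rewrite !chi_sym raddfB. Qed.

Lemma chi0l y : chi 0 y = 0.
Proof. by rewrite chi_sym raddf0. Qed.

Lemma lfun_chr phi : {morph (fun v : V => phi v : 'F_2) : u v / u + v}.
Proof. by move=> u v; rewrite linearD. Qed.

Lemma eval_chr v : {morph (fun phi : dualv V => phi v : 'F_2) : f g / f + g}.
Proof. by move=> f g; rewrite add_lfunE. Qed.

Lemma chi_powl k x y : x \in gr_pow k -> (2 ^+ k %| chi x y)%Z.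
Proof.
move=> xk; elim/freeg_ind: y => [|y y' IHy IHy'|phi]; first by rewrite raddf0 dvdz0.
  by rewrite raddfB rpredB.
by rewrite chiU gr_sgn_pow //; first exact: lfun_chr.
Qed.

Lemma chi_powr k x y : y \in gr_pow k -> (2 ^+ k %| chi x y)%Z.
Proof.
move=> yk; rewrite chi_sym; elim/freeg_ind: x => [|x x' IHx IHx'|v].
- by rewrite raddf0 dvdz0.
- by rewrite raddfB rpredB.
by rewrite fliftU gr_sgn_pow //; first exact: eval_chr.
Qed.

Lemma chi_aug_pt v phi :
  chi (val (aug_pt v)) (val (aug_pt phi)) = if phi v != 0 then -2 else 0.
Proof.
rewrite !val_aug_pt /aug_gen raddfB chiBl /= !chiBl !chiU !gr_sgnU.
by rewrite !linear0 !zero_lfunE /sgnF; case: (phi v != 0).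
Qed.

Section DualBases.
Context (d : nat) (v_ : 'I_d -> V) (phi_ : 'I_d -> dualv V).
Hypothesis dualb : forall i j, phi_ i (v_ j) = (i == j)%:R.

(** Adding phi_i to a form psi changes only the sign psi assigns to v_i. So it does
    nothing to chi(e_S, [psi]) if i is not in S; otherwise only the factor at i
    changes, by -2 chi([v_i], [psi]), and [v_i] = ([v_i] - 1) + 1 splits the result
    into the two terms on the right. *)
Lemma chi_mon_gen S i y :
  chi (aug_mon v_ S) (aug_gen (phi_ i) * y) =
  if i \in S then -2 * (chi (aug_mon v_ S) y + chi (aug_mon v_ (S :\ i)) y) else 0.
Proof.
elim/freeg_ind: y => [|y y' IHy IHy'|psi].
- by rewrite mulr0 !raddf0; case: ifP.
- rewrite mulrBr !raddfB /= IHy IHy'; case: ifP => _; last by rewrite subr0.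
  by ring.
rewrite mulrBl mul1r grU raddfB /= !chiU !gr_sgn_mon; try exact: lfun_chr.
under eq_bigr => j _ do rewrite add_lfunE sgnFD dualb.
case: ifP => iS; last first.
  rewrite (eq_bigr (fun j => sgnF (psi (v_ j)) - 1)) ?subrr // => j jS.
  by case: eqP => [ij|_]; [rewrite ij jS in iS | rewrite mul1r].
rewrite (big_setD1 i) //= [X in _ - X](big_setD1 i) //= [X in _ * (X + _)](big_setD1 i) //=.
rewrite (eq_bigr (fun j => sgnF (psi (v_ j)) - 1)) => [|j].
  by rewrite eqxx (_ : sgnF 1 = -1) //; ring.
by rewrite in_setD1 eq_sym => /andP[/negPf-> _]; rewrite mul1r.
Qed.

(** Remove the elements of T one by one with chi_mon_gen: an index of T outside S
    gives 0, and an index i common to both gives -2 times the sum of the values for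
    (S, T \ i), which vanishes by induction, and for (S \ i, T \ i). *)
Lemma chi_mon S T :
  chi (aug_mon v_ S) (aug_mon phi_ T) = (S == T)%:R * (- 2) ^+ #|S|.
Proof.
elim: {T}_.+1 {-2}T (ltnSn #|T|) S => // m IHm T leT S.
have [->|[i iT]] := set_0Vmem T.
  rewrite /aug_mon big_set0 chiU gr_sgn_mon; last exact: lfun_chr.
  have [->|[i iS]] := set_0Vmem S; first by rewrite big_set0 eqxx cards0.
  rewrite (bigD1 i) //= zero_lfunE subrr mul0r.
  by case: eqP iS => [->|]; rewrite ?inE ?mul0r.
have cT := cardsD1 i T; rewrite iT in cT.
rewrite (aug_monD1 phi_ iT) chi_mon_gen !IHm; try lia.
case: ifP => iS; last by case: eqP iS => [->|]; rewrite ?iT ?mul0r.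
have -> : (S == T :\ i) = false by apply: contraTF iS => /eqP->; rewrite !inE eqxx.
have -> : (S :\ i == T :\ i) = (S == T).
  apply/eqP/eqP => [ST|-> //]; by rewrite -(setD1K iS) ST setD1K.
have -> : #|S| = #|S :\ i|.+1 by rewrite (cardsD1 i S) iS.
by rewrite mul0r add0r exprS mulrCA.
Qed.

Lemma chi_mon_sum (a : {set 'I_d} -> int) T : T != set0 ->
  chi (\sum_(S | S != set0) aug_mon v_ S *~ a S) (aug_mon phi_ T) = a T * (- 2) ^+ #|T|.
Proof.
move=> T0; rewrite chi_sym raddf_sum (bigD1 T) //= big1 => [|S /andP[_ ST]].
  by rewrite addr0 raddfMz /= -chi_sym chi_mon // eqxx mul1r -mulrzl intz.
by rewrite raddfMz /= -chi_sym chi_mon // (negPf ST) mul0r mul0rz.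
Qed.

End DualBases.

End SignPairing.

(** This adjunction is the naturality of the pairing. *)
Lemma chi_map (U V : vectType 'F_2) (f : 'Hom(U, V)) x y :
  chi (gr_map f x) y = chi x (gr_map (transpose f) y).
Proof.
elim/freeg_ind: y => [|y y' IHy IHy'|phi]; first by rewrite !raddf0.
  by rewrite !raddfB /= IHy IHy'.
rewrite gr_mapU !chiU; elim/freeg_ind: x => [|x x' IHx IHx'|u]; first by rewrite !raddf0.
  by rewrite !raddfB /= IHx IHx'.
by rewrite gr_mapU !gr_sgnU transposeE comp_lfunE.
Qed.

Lemma F2_scale (W : vectType 'F_2) (a : 'F_2) (w : W) :
  a *: w = if a != 0 then w else 0.
Proof.
case: (eqVneq a 0) => [->|a0]; first by rewrite scale0r.
by have -> : a = 1; [move: a a0 => [[|[|[]]] //] a _; apply: val_inj | rewrite scale1r].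
Qed.

Lemma dual_bases (V : vectType 'F_2) :
  exists d (v_ : 'I_d -> V) (phi_ : 'I_d -> dualv V),
  [/\ forall i j, phi_ i (v_ j) = (i == j)%:R,
      forall v, exists S : {set 'I_d}, v = \sum_(i in S) v_ i
    & forall phi, exists S : {set 'I_d}, phi = \sum_(i in S) phi_ i].
Proof.
pose X := vbasis (fullv : {vspace V}).
have XV : basis_of fullv X by exact: vbasisP.
pose v_ (i : 'I_(\dim {:V})) : V := X`_i.
pose phi_ i : dualv V := linfun (coord X i : V -> ('F_2)^o).
have dualb i j : phi_ i (v_ j) = (i == j)%:R.
  by rewrite lfunE /= coord_free ?(basis_free XV) // eq_sym.
have decv v : v = \sum_i phi_ i v *: v_ i.
  by rewrite {1}(coord_basis XV (memvf v)); apply: eq_bigr => i _; rewrite lfunE.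
exists _, v_, phi_; split=> // [v|phi].
  exists [set i | phi_ i v != 0]; rewrite {1}[v]decv [RHS]big_mkcond.
  by apply: eq_bigr => i _; rewrite inE F2_scale.
exists [set i | phi (v_ i) != 0]; rewrite big_mkcond; apply/lfunP => v.
rewrite {1}[v]decv linear_sum sum_lfunE; apply: eq_bigr => i _.
rewrite inE linearZ /= -[LHS]/(phi_ i v * phi (v_ i)) mulrC -[LHS]/(phi (v_ i) *: phi_ i v).
by rewrite -scale_lfunE F2_scale; case: ifP => _; rewrite ?zero_lfunE.
Qed.

(** * The transformations from R^n to its dual induced by the pairing *)

Section Theta.
Context (n : nat) (c : pruefer).
Hypothesis c0 : c *+ 2 ^ n.+1 = 0.

Section Object.
Context (V : vectType 'F_2).

Definition pair_fun (x : augI V) (y : augI (dualv V)) : pruefer := c *~ chi (val x) (val y).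

Fact pair_fun_is_zmod_morphism x : zmod_morphism (pair_fun x).
Proof. by move=> y y'; rewrite /pair_fun !raddfB. Qed.
HB.instance Definition _ x := GRing.isZmodMorphism.Build (augI (dualv V)) pruefer
  (pair_fun x) (pair_fun_is_zmod_morphism x).

Fact theta_row_subproof x y :
  y \in @augpow_pred (dualv V) n.+1 -> pair_fun x y = 0.
Proof. by rewrite -gr_powE => yn; apply/(mulz_dvd_eq0 c0)/chi_powr. Qed.

Definition theta_row (x : augI V) : Dobj (Rn n) V :=
  mkaddhom (qlift (theta_row_subproof x)).

Lemma theta_rowE x y : theta_row x (Rpi _ n y) = c *~ chi (val x) (val y).
Proof. exact: (qlift_pi (@theta_row_subproof x) y). Qed.

Lemma eq_Dobj (a b : Dobj (Rn n) V) :
  (forall y, a (Rpi _ n y) = b (Rpi _ n y)) -> a = b.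
Proof. by move=> ab; apply: addhomP => y; have [y' <-] := Rpi_surj y. Qed.

Fact theta_row_is_zmod_morphism : zmod_morphism theta_row.
Proof.
move=> x x'; apply: eq_Dobj => y.
by rewrite addhomBE !theta_rowE raddfB chiBl mulrzBr.
Qed.
HB.instance Definition _ := GRing.isZmodMorphism.Build (augI V) (Dobj (Rn n) V)
  theta_row theta_row_is_zmod_morphism.

Fact theta_subproof x : x \in @augpow_pred V n.+1 -> theta_row x = 0.
Proof.
rewrite -gr_powE => xn; apply: eq_Dobj => y.
by rewrite theta_rowE (mulz_dvd_eq0 c0) // chi_powl.
Qed.

Definition theta_map : {additive Robj V n -> Dobj (Rn n) V} := qlift theta_subproof.

Lemma theta_mapE x y : theta_map (Rpi _ n x) (Rpi _ n y) = c *~ chi (val x) (val y).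
Proof.
exact: etrans (congr1 (fun a : Dobj (Rn n) V => a (Rpi _ n y))
                 (qlift_pi theta_subproof x)) (theta_rowE x y).
Qed.

End Object.

Fact theta_natural (U V : vectType 'F_2) (f : 'Hom(U, V)) (x : Rn n U) :
  theta_map V (fmap (Rn n) f x) = fmap (pdual (Rn n)) f (theta_map U x).
Proof.
have [x' <-] := Rpi_surj x; apply: eq_Dobj => y.
rewrite [fmap _ _ _]Rmap_pi theta_mapE.
rewrite -[RHS]/(theta_map U (Rpi U n x') (Rmap (transpose f) n (Rpi _ n y))).
rewrite Rmap_pi theta_mapE.
by rewrite chi_map.
Qed.

Definition theta : nattrans (Rn n) (pdual (Rn n)) :=
  @NatTrans (Rn n) (pdual (Rn n)) theta_map theta_natural.

Hypothesis cN0 : c *+ 2 ^ n != 0.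

(** Pairing x = sum_S a_S e_S with e*_T isolates a_T (-2)^|T| c. If this vanishes
    then 2^(n+1-|T|) divides a_T, so that a_T e_T is in I^(n+1). *)
Lemma theta_inj (V : vectType 'F_2) (x : Rn n V) : theta V x = 0 -> x = 0.
Proof.
have [{}x <-] := Rpi_surj x => tx0; apply/eqP; rewrite Rpi_eq0 -gr_powE.
have [d [v_ [phi_ [dualb gen _]]]] := dual_bases V.
have [a xE] := aug_mon_span gen (valP x).
rewrite xE; apply: gr_pow_sum => T T0.
pose y := AugI (aug_mon_pred phi_ T0).
have : c *~ chi (val x) (val y) = 0 by rewrite -theta_mapE [theta_map _ _]tx0.
rewrite xE (chi_mon_sum dualb) //= => /(exact_order_dvd c0 cN0) /dvdz_exp_cancel /dvdzP[q ->].
rewrite mulrC mulrzA -natrX natz -pmulrn.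
by apply/gr_powMz/aug_mon_pow => //; rewrite addnC -leq_subLR.
Qed.

(** By diagonality the coefficients of a preimage can be chosen independently: the
    coefficient of e_T only has to produce the value of h on e*_T. *)
Lemma theta_surj (V : vectType 'F_2) (h : pdual (Rn n) V) : exists x, theta V x = h.
Proof.
have [d [v_ [phi_ [dualb gen gen']]]] := dual_bases V.
have h_a T : exists a, T != set0 ->
    h (Rpi _ n (aug_red (aug_mon phi_ T))) = c *~ (a * (- 2) ^+ #|T|).
  have [->|T0] := eqVneq T set0; first by exists 0.
  have : h (Rpi _ n (aug_red (aug_mon phi_ T))) *+ 2 ^ (n.+1 - #|T|) = 0.
    rewrite -2!raddfMn (_ : Rpi _ n _ = 0) ?raddf0 //; apply/eqP.
    rewrite Rpi_eq0 -gr_powE raddfMn [X in X *+ _]aug_red_val ?aug_mon_pred //.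
    by apply: aug_mon_pow => //; rewrite addnC -leq_subLR.
  by move=> /(exact_order_gen_exp c0 cN0)[a ha]; exists a.
have [a {}h_a] := choice h_a.
have [x xE] : exists x : augI V, val x = \sum_(S | S != set0) aug_mon v_ S *~ a S.
  exists (\sum_(S | S != set0) aug_red (aug_mon v_ S) *~ a S).
  rewrite raddf_sum; apply: eq_bigr => S S0.
  by rewrite raddfMz [X in X *~ _]aug_red_val ?aug_mon_pred.
exists (Rpi _ n x); apply: eq_Dobj => y.
have [b yE] := aug_mon_span gen' (valP y).
rewrite -(aug_redK y) yE !raddf_sum; apply: eq_bigr => T T0.
rewrite !raddfMz; congr (_ *~ _); rewrite [RHS]h_a // [LHS]theta_mapE xE.
by rewrite aug_red_val ?aug_mon_pred // (chi_mon_sum dualb).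
Qed.

End Theta.

Section PointwiseBijection.
Context (F G : vfunctor) (t : nattrans F G).
Hypothesis t_inj : forall (V : vectType 'F_2) (x : F V), t V x = 0 -> x = 0.
Hypothesis t_surj : nat_surjective t.

Let s V (y : G V) : F V := sval (cid (t_surj y)).

Let sK V : cancel (@s V) (t V).
Proof. by move=> y; rewrite /s; case: cid. Qed.

Let tK V : cancel (t V) (@s V).
Proof.
by move=> x; apply/eqP; rewrite -subr_eq0; apply/eqP/t_inj; rewrite raddfB sK subrr.
Qed.

Fact pointwise_inverse_is_zmod_morphism V : zmod_morphism (@s V).
Proof. by move=> x y; apply: (can_inj (@tK V)); rewrite raddfB !sK. Qed.

Let sa V : {additive G V -> F V} :=
  HB.pack_for {additive G V -> F V} (@s V)
    (GRing.isZmodMorphism.Build _ _ (@s V) (@pointwise_inverse_is_zmod_morphism V)).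

Lemma pointwise_bijection_iso : nat_iso t.
Proof.
unshelve eexists (@NatTrans G F sa _); last by move=> V; split; [apply: tK | apply: sK].
move=> U V f x; apply: (can_inj (@tK V)).
rewrite naturality; exact: etrans (sK _) (esym (congr1 (fmap G f) (sK x))).
Qed.

End PointwiseBijection.

(** * Transformations out of the 2-adic augmentation ideal *)

Lemma Z2_seq_red (z : Z2) m j : (Z2_seq z (m + j)%N : nat)%:R = Z2_seq z m.
Proof.
elim: j => [|j IHj]; first by rewrite addn0 natr_Zp.
rewrite -IHj -(Z2_redP z (m + j)%N) /Zpow2_red val_Zpow2_nat.
by rewrite Zpow2_natr_mod ?addnS ?leq_addr.
Qed.

Lemma Z2_eqP (z z' : Z2) : (forall m, Z2_seq z m = Z2_seq z' m) -> z = z'.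
Proof. by move=> zz'; apply/val_inj/functional_extensionality_dep. Qed.

Lemma Z2_seqMn (z : Z2) k m : Z2_seq (z *+ k) m = Z2_seq z m *+ k.
Proof.
elim: k => [|k IHk]; first by rewrite !mulr0n.
by rewrite !mulrS Z2D IHk.
Qed.

(** Component k of a 2-adic integer is its class modulo 2^(k+1); the quotient of the
    difference by 2^(k+1) is computed on representatives. *)
Lemma Z2_div (z : Z2) k : exists z' : Z2, z = 1 *+ (Z2_seq z k : nat) + z' *+ 2 ^ k.+1.
Proof.
pose w := z - 1 *+ (Z2_seq z k : nat).
have wk : Z2_seq w k = 0.
  have := Z2D w (1 *+ (Z2_seq z k : nat)) k; rewrite subrK Z2_seqMn natr_Zp.
  by move/eqP; rewrite -{1}[Z2_seq z k]add0r (inj_eq (addIr _)) => /eqP <-.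
pose a m : nat := Z2_seq w m.
pose q m : 'Z_(2 ^ m.+1) := (a (m + k.+1)%N %/ 2 ^ k.+1)%:R.
have qZ2 : (q : Zpow2_prod) \in Z2_pred.
  apply/asboolP => m; rewrite /q Zpow2_red_nat.
  have -> : a (m + k.+1)%N = (a (m.+1 + k.+1) %% (2 ^ m.+1 * 2 ^ k.+1))%N.
    by rewrite -expnD /a addSn -(Z2_redP w (m + k.+1)) /Zpow2_red val_Zpow2_nat.
  by rewrite -modn_divl Zpow2_natr_mod.
have a_dvd m : (2 ^ k.+1 %| a (m + k.+1))%N.
  have := Z2_seq_red w k m.+1; rewrite wk => /(congr1 (@nat_of_ord _)).
  by rewrite val_Zpow2_nat -/(a _) addnS -addSn addnC /dvdn => ->.
exists (MkZ2 qZ2); apply/eqP; rewrite addrC -subr_eq; apply/eqP/Z2_eqP => m.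
rewrite -/w Z2_seqMn /= /q -[RHS]mulr_natr -natrM divnK //.
by rewrite Z2_seq_red.
Qed.

Lemma tens0r (A B : zmodType) (a : A) : tens a (0 : B) = 0.
Proof. by apply: (addrI (tens a 0)); rewrite -tensDr !addr0. Qed.

Lemma tensBr (A B : zmodType) (a : A) (b b' : B) : tens a (b - b') = tens a b - tens a b'.
Proof. by apply: (addIr (tens a b')); rewrite -tensDr !subrK. Qed.

(** Only the class of z modulo 2^n matters, since M is killed by 2^n; component n of
    z, its class modulo 2^(n+1), determines it. *)
Lemma Z2_tens_killed (A M : zmodType) (f : {additive tensor Z2 A -> M}) n z a :
  (forall y : M, y *+ 2 ^ n = 0) ->
  f (tens z a) = f (tens 1 a) *+ (Z2_seq z n : nat).
Proof.
move=> M0.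
have tensMn (x : Z2) k : tens (x *+ k) a = tens x a *+ k.
  elim: k => [|k IHk]; last by rewrite !mulrS tensDl IHk.
  by apply: (addrI (tens 0 a)); rewrite -tensDl !addr0.
have [z' {1}->] := Z2_div z n; rewrite tensDl !tensMn raddfD !raddfMn /=.
have {}M0 (y : M) : y *+ 2 ^ n.+1 = 0 by rewrite expnSr mulrnA M0 mul0rn.
by rewrite M0 addr0.
Qed.

Lemma addhom0E (A B : zmodType) x : (0 : addhom A B) x = 0.
Proof. by rewrite -(subrr (0 : addhom A B)) addhomBE subrr. Qed.

Lemma addhomMnE (A B : zmodType) (h : addhom A B) k x : (h *+ k) x = h x *+ k.
Proof.
elim: k => [|k IHk]; first by rewrite !mulr0n addhom0E.
rewrite !mulrSr -[h in _ + h]opprK addhomBE IHk -[- h]sub0r.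
by rewrite addhomBE addhom0E sub0r opprK.
Qed.

Definition F2line : vectType 'F_2 := ('F_2)^o.
Definition unit_vec : F2line := 1.
Definition unit_form : dualv F2line := \1%VF.

Fact line_is_linear (V : vectType 'F_2) (v : V) :
  linear (fun a : F2line => (a : 'F_2) *: v).
Proof. by move=> k a b; rewrite scalerDl -scalerA. Qed.

Definition line (V : vectType 'F_2) (v : V) : 'Hom(F2line, V) :=
  linfun (HB.pack_for {linear F2line -> V} (fun a : F2line => (a : 'F_2) *: v)
    (GRing.isLinear.Build _ _ _ _ _ (line_is_linear v))).

Lemma lineE (V : vectType 'F_2) (v : V) : line v unit_vec = v.
Proof. by rewrite lfunE /= scale1r. Qed.

Lemma comp_line (V : vectType 'F_2) (v : V) (phi : dualv V) :
  (phi \o line v)%VF = if phi v != 0 then unit_form else 0.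
Proof.
apply/lfunP => a; rewrite comp_lfunE lfunE /= linearZ /= -[LHS]/(a * phi v) mulrC.
rewrite -[LHS]/((phi v : 'F_2) *: (a : F2line)) F2_scale.
by case: ifP => _; rewrite ?id_lfunE ?zero_lfunE.
Qed.

Section Universal.
Context (n : nat) (f : nattrans barPZ2 (pdual (Rn n))).

Definition nat_const : pruefer :=
  f F2line (tens 1 (aug_pt unit_vec)) (Rpi _ n (aug_pt unit_form)).

(** Along the line through v, [v] - 1 is the image of [1] - 1 and phi pulls back to
    the identity form or to 0, according to phi(v). *)
Lemma nat_constE (V : vectType 'F_2) (v : V) (phi : dualv V) :
  f V (tens 1 (aug_pt v)) (Rpi _ n (aug_pt phi)) = if phi v != 0 then nat_const else 0.
Proof.
have -> : tens 1 (aug_pt v) = fmap barPZ2 (line v) (tens 1 (aug_pt unit_vec)).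
  by rewrite [RHS]tens_mapE [fmap _ _ _]aug_map_red gr_mapU lineE.
rewrite naturality.
rewrite -[LHS]/(f F2line (tens 1 (aug_pt unit_vec))
                  (Rmap (transpose (line v)) n (Rpi _ n (aug_pt phi)))).
rewrite Rmap_pi aug_map_red gr_mapU transposeE comp_line.
by case: ifP => // _; rewrite -/(aug_pt _) aug_pt0 !raddf0.
Qed.

Lemma nat_const_torsion : nat_const *+ 2 ^ n = 0.
Proof. by rewrite -raddfMn Rn_killed raddf0. Qed.

(** Both sides are additive in every variable, so it suffices to compare them at
    [v] - 1 and [phi] - 1, where chi is -2 or 0 according to phi(v). *)
Lemma nattrans_theta c (c0 : c *+ 2 ^ n.+1 = 0) : nat_const = - (c *+ 2) ->
  forall V x, f V x = theta c0 V (Rproj n V x).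
Proof.
move=> cE V.
apply: (@eq_tensor_additive _ _ _ (f V) (theta c0 V \o Rproj n V)) => z x.
rewrite (@Z2_tens_killed _ _ _ n) => [|y]; last first.
  apply: eq_Dobj => y'; rewrite addhomMnE -raddfMn Rn_killed raddf0.
  by rewrite [RHS]addhom0E.
rewrite -[RHS]/(theta c0 V (Rproj_fun n V (tens z x))) Rproj_tens /Z2_act raddfMn.
congr (_ *+ _).
apply: eq_Dobj => y; rewrite [RHS]theta_mapE.
elim/aug_ind: x => [|x x' IHx IHx'|v].
- by rewrite raddf0 chi0l tens0r raddf0.
- by rewrite raddfB chiBl tensBr !raddfB addhomBE /= IHx IHx'.
elim/aug_ind: y => [|y y' IHy IHy'|phi]; first by rewrite !raddf0.
  by rewrite !raddfB /= IHy IHy'.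
rewrite nat_constE chi_aug_pt cE; case: ifP => _; last by rewrite mulr0z.
by rewrite mulrNz.
Qed.

(** At V = F_2 the form theta (1/2^(n+1)) ([1] - 1) takes on [id] - 1 the value -1/2^n,
    of order 2^n. If f reaches it, it is chi(x, [id] - 1) c for some x in I(F_2).
    As this integer is even, the value would be killed by 2^(n-1) if 2^n c were 0. *)
Lemma surj_nat_const c (c0 : c *+ 2 ^ n.+1 = 0) : (0 < n)%N -> nat_surjective f ->
  nat_const = - (c *+ 2) -> c *+ 2 ^ n != 0.
Proof.
move=> n0 f_surj cE; apply/eqP => c_n.
have u0 := pfrac_killed n.+1 1.
have [xi xiE] := f_surj F2line (theta u0 F2line (Rpi _ n (aug_pt unit_vec))).
have [x xE] := Rpi_surj (Rproj n F2line xi).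
pose y := aug_pt unit_form.
have /dvdzP[q chiE] : (2 ^+ 1 %| chi (val x) (val y))%Z.
  by apply/chi_powr/gr_pow1/valP.
have : theta u0 F2line (Rpi _ n (aug_pt unit_vec)) (Rpi _ n y) *+ 2 ^ n.-1 = 0.
  rewrite -xiE (nattrans_theta c0 cE) -xE [X in X *+ _]theta_mapE chiE mulrC mulrzA.
  have c2 : c *~ 2 *+ 2 ^ n.-1 = 0 by rewrite -pmulrn -mulrnA -expnS prednK.
  by rewrite pmulrn mulrzAC -pmulrn c2 mul0rz.
rewrite [X in X *+ _]theta_mapE chi_aug_pt id_lfunE oner_eq0 /= mulrNz mulNrn.
rewrite -pmulrn -mulrnA -expnS prednK // => /eqP.
by rewrite oppr_eq0 (negPf (pfrac_unit n)).
Qed.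

End Universal.

Theorem theorem3p12 (n : nat) (hn : (0 < n)%N) :
  (exists t : nattrans (Rn n) (pdual (Rn n)), nat_iso t) /\
  (forall f : nattrans barPZ2 (pdual (Rn n)), nat_surjective f ->
     exists t : nattrans (Rn n) (pdual (Rn n)),
       [/\ nat_iso t,
           (forall (V : vectType 'F_2) (x : barPZ2 V),
              f V x = t V (Rproj n V x))
         & (forall t' : nattrans (Rn n) (pdual (Rn n)),
              (forall (V : vectType 'F_2) (x : barPZ2 V),
                 f V x = t' V (Rproj n V x)) ->
              forall (V : vectType 'F_2) (y : Rn n V), t' V y = t V y)]).
Proof.
have theta_iso c (c0 : c *+ 2 ^ n.+1 = 0) : c *+ 2 ^ n != 0 -> nat_iso (theta c0).
  by move=> cN0; apply: pointwise_bijection_iso; [apply: theta_inj | apply: theta_surj].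
split.
  exists (theta (pfrac_killed n.+1 1)); apply: theta_iso.
  by apply: pfrac_unit.
move=> f f_surj.
have [c' cE'] := pruefer_half (nat_const f).
have cE : nat_const f = - (- c' *+ 2) by rewrite mulNrn opprK.
have c0 : - c' *+ 2 ^ n.+1 = 0.
  by rewrite expnS mulrnA mulNrn cE' mulNrn nat_const_torsion oppr0.
have fE := nattrans_theta c0 cE.
exists (theta c0); split=> // [|t' t'E V y].
  exact: theta_iso (surj_nat_const c0 hn f_surj cE).
by have [x <-] := Rproj_surjective y; rewrite -t'E fE.
Qed.
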